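(* Let $\mathcal{H}$ be a complex separable Hilbert space, let $A\in\mathcal{B}(\mathcal{H})$, let $0<L<\infty$, and let $\mathcal{G}\subset\mathcal{H}$ be a countable Bessel system. The following are equivalent: (i) $\{e^{tA}g\}_{g\in\mathcal{G},\,t\in[0,L]}$ is a semi-continuous frame for $\mathcal{H}$. (ii) There exists $\delta>0$ such that for every finite set $T=\{t_1,\dots,t_n\}$ with $0=t_1<t_2<\dots<t_n\le t_{n+1}:=L$ and $|t_{j+1}-t_j|<\delta$ for all $j\in\{1,\dots,n\}$, the system $\{e^{tA}g\}_{g\in\mathcal{G},\,t\in T}$ is a frame for $\mathcal{H}$. (iii) There exists a finite set $T=\{t_1,\dots,t_n\}$ with $0=t_1<t_2<\dots<t_n\le L$ such that $\{e^{tA}g\}_{g\in\mathcal{G},\,t\in T}$ is a frame for $\mathcal{H}$.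
   Context: For $A\in\mathcal{B}(\mathcal{H})$, $e^{tA}:=\sum_{n\ge0}\frac{t^n}{n!}A^n$. A countable family $\{f_k\}\subset\mathcal{H}$ is a Bessel system if there is $C>0$ with $\sum_k|\langle f,f_k\rangle|^2\le C\|f\|^2$ for all $f\in\mathcal{H}$, and a frame if moreover there is $c>0$ with $c\|f\|^2\le\sum_k|\langle f,f_k\rangle|^2$ for all $f$. For a countable $\mathcal{G}\subset\mathcal{H}$ and an interval $\mathcal{T}\subset[0,\infty)$, $\{e^{tA}g\}_{g\in\mathcal{G},t\in\mathcal{T}}$ is a semi-continuous frame for $\mathcal{H}$ if there are constants $c,C>0$ such that $c\|f\|^2\le\sum_{g\in\mathcal{G}}\int_{\mathcal{T}}|\langle f,e^{tA}g\rangle|^2\,dt\le C\|f\|^2$ for all $f\in\mathcal{H}$. *)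

(* Defs.v *)
From HB Require Import structures.
From mathcomp Require Import all_boot all_order all_algebra.
From mathcomp Require Import all_classical all_reals all_analysis.
From mathcomp Require Import complex.
Set Implicit Arguments. Unset Strict Implicit. Unset Printing Implicit Defensive.
Import Order.TTheory GRing.Theory Num.Theory.
Local Open Scope ring_scope.
Local Open Scope classical_set_scope.

Section Hilbert.
Variable R : realType.
Local Notation C := (R[i]).

Definition cabs2 (z : C) : R := complex.Re z ^+ 2 + complex.Im z ^+ 2.

Variable V : lmodType C.
Variable ip : V -> V -> C.

Definition nsq (x : V) : R := complex.Re (ip x x).

Record is_sep_Hilbert : Prop := IsSepHilbert {
  ip_linear : forall (a : C) (x y z : V), ip (a *: x + y) z = a * ip x z + ip y z;
  ip_conj : forall x y : V, ip y x = conjc (ip x y);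
  ip_pos : forall x : V, x != 0 -> 0 < complex.Re (ip x x);
  complete : forall u : nat -> V,
    (forall e : R, 0 < e -> exists N, forall m n, (N <= m)%N -> (N <= n)%N ->
        nsq (u m - u n) < e) ->
    exists l : V, forall e : R, 0 < e -> exists N, forall n, (N <= n)%N ->
        nsq (u n - l) < e;
  separable : exists d : nat -> V, forall (x : V) (e : R), 0 < e ->
    exists n, nsq (x - d n) < e }.

Definition bounded_op (A : {linear V -> V}) : Prop :=
  exists M : R, forall x, nsq (A x) <= M * nsq x.

Definition is_exp_op (A : {linear V -> V}) (E : R -> V -> V) : Prop :=
  forall (t : R) (x : V) (e : R), 0 < e -> exists N, forall n, (N <= n)%N ->
    nsq (\sum_(k < n) ((t ^+ k / (k`!)%:R)%:C)%C *: iter k A x - E t x) < e.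

Definition bessel_fam (I : choiceType) (S : set I) (u : I -> V) : Prop :=
  exists Cb : R, 0 < Cb /\ forall f : V,
    (\esum_(i in S) (cabs2 (ip f (u i)))%:E <= (Cb * nsq f)%:E)%E.

Definition frame_fam (I : choiceType) (S : set I) (u : I -> V) : Prop :=
  exists c Cb : R, [/\ 0 < c, 0 < Cb & forall f : V,
    ((c * nsq f)%:E <= \esum_(i in S) (cabs2 (ip f (u i)))%:E)%E /\
    (\esum_(i in S) (cabs2 (ip f (u i)))%:E <= (Cb * nsq f)%:E)%E].

Definition semicont_frame (E : R -> V -> V) (G : set V) (L : R) : Prop :=
  exists c Cb : R, [/\ 0 < c, 0 < Cb & forall f : V,
    let F := \esum_(g in G)
       (\int[@lebesgue_measure R]_(t in `[0%R, L]%classic) (cabs2 (ip f (E t g)))%:E)%E in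
    ((c * nsq f)%:E <= F)%E /\ (F <= (Cb * nsq f)%:E)%E].

(* the finite set {t_1, ..., t_n} (0-based here: t 0, ..., t (n-1)) *)
Definition tset (n : nat) (t : nat -> R) : set R := [set t j | j in [set j | (j < n)%N]].

End Hilbert.

(* Main.v *)
(** The adjoint of [e^(tA)] is avoided: if [B] is bounded and [G] is Bessel, then
    [B G] is Bessel with bound [C ||B||^2], because the coefficients
    [c_g = <f, B g>] satisfy [\sum |c_g|^2 = <f, B h>] with [h = \sum c_g g] and
    [||h||^2 <= C \sum |c_g|^2]. Applied to [B = e^(tA) - e^(sA)], whose norm is
    [O(|t - s|)] on [0, L], this makes [\sum_g |<f, e^(tA) g>|^2] vary slowly:
    at [t] it is at most twice its value at [s] plus [K (t - s)^2 ||f||^2].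
    Integrating in [t] over [0, L], with [s] the nearest sampling time, gives
    (i) => (ii); integrating over a short interval around each sampling time
    gives (iii) => (i). In both cases the error term is absorbed in the lower
    frame bound. *)
Require Import Defs.
From HB Require Import structures.
From mathcomp Require Import all_boot all_order all_algebra.
From mathcomp Require Import all_classical all_reals all_analysis.
From mathcomp Require Import complex measurable_realfun.
From mathcomp Require Import ring lra.
Import Order.TTheory GRing.Theory Num.Theory.
Import numFieldNormedType.Exports.
Local Open Scope ring_scope.
Local Open Scope classical_set_scope.

(** * Inner product, norm and Cauchy-Schwarz *)

Section InnerProduct.
Set Implicit Arguments. Unset Strict Implicit.
Variables (R : realType) (V : lmodType R[i]) (ip : V -> V -> R[i]).
Hypothesis hH : is_sep_Hilbert ip.

Lemma ipDl x y z : ip (x + y) z = ip x z + ip y z.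
Proof. by rewrite -[in LHS](scale1r x) (ip_linear hH) mul1r. Qed.

Lemma ip0l z : ip 0 z = 0.
Proof. by apply: (addrI (ip 0 z)); rewrite -ipDl !addr0. Qed.

Lemma ipZl a x z : ip (a *: x) z = a * ip x z.
Proof. by rewrite -[a *: x]addr0 (ip_linear hH) ip0l addr0. Qed.

Lemma ipDr x y z : ip z (x + y) = ip z x + ip z y.
Proof. by rewrite !(ip_conj hH _ z) ipDl rmorphD. Qed.

Lemma ip0r z : ip z 0 = 0.
Proof. by rewrite (ip_conj hH) ip0l rmorph0. Qed.

Lemma ipZr a x z : ip z (a *: x) = conjc a * ip z x.
Proof. by rewrite !(ip_conj hH _ z) ipZl rmorphM. Qed.

Lemma ipNr x z : ip z (- x) = - ip z x.
Proof. by rewrite -scaleN1r ipZr rmorphN1 mulN1r. Qed.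

Lemma ip_sumr (I : Type) (s : seq I) (F : I -> V) z :
  ip z (\sum_(i <- s) F i) = \sum_(i <- s) ip z (F i).
Proof. exact: (big_morph (ip z) (fun x y => ipDr x y z) (ip0r z)). Qed.

Lemma nsq_ge0 x : 0 <= nsq ip x.
Proof.
have [->|/(ip_pos hH)/ltW//] := eqVneq x 0.
by rewrite /nsq ip0l.
Qed.

Lemma nsqD x y : nsq ip (x + y) = nsq ip x + nsq ip y + 2 * complex.Re (ip x y).
Proof.
rewrite /nsq !ipDl !ipDr (ip_conj hH x y).
by case: (ip x x) (ip x y) (ip y y) => [a b] [c d] [e f] /=; ring.
Qed.

Lemma nsqZ a x : nsq ip (a *: x) = cabs2 a * nsq ip x.
Proof.
have : complex.Im (ip x x) = 0.
  by move: (ip_conj hH x x); case: (ip x x) => a' b [] /=; lra.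
rewrite /nsq ipZl ipZr /cabs2; case: a (ip x x) => [a b] [c d] /= ->; ring.
Qed.

Lemma nsqN x : nsq ip (- x) = nsq ip x.
Proof. by rewrite -scaleN1r nsqZ /cabs2 /= oppr0 expr0n addr0 sqrrN expr1n mul1r. Qed.

Lemma cabs2_ge0 (z : R[i]) : 0 <= cabs2 z.
Proof. by rewrite addr_ge0 ?sqr_ge0. Qed.

Lemma cabs2_real (a : R) : cabs2 (a%:C)%C = a ^+ 2.
Proof. by rewrite /cabs2 /= expr0n addr0. Qed.

Lemma Re_realM (a : R) (z : R[i]) : complex.Re ((a%:C)%C * z) = a * complex.Re z.
Proof. by case: z => c d /=; ring. Qed.

(** Expand the nonnegative [nsq ip (l x - y)] and divide by [l]. *)
Lemma young_ip (l : R) x y : 0 < l ->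
  2 * complex.Re (ip x y) <= l * nsq ip x + l^-1 * nsq ip y.
Proof.
move=> l0; have := nsq_ge0 ((l%:C)%C *: x - y).
rewrite nsqD nsqZ nsqN cabs2_real ipNr ipZl -mulrN Re_realM raddfN /= mulrN.
move=> h; rewrite -(ler_pM2l l0) mulrDr !mulrA mulfV ?gt_eqF// mul1r.
by move: h; set a := complex.Re _; move: a => a; lra.
Qed.

(** With [p = nsq ip x], [q = nsq ip y] and [b = Re (ip x y)], the squared norm of [p y - b x]
    equals [p (p q - b^2)], and [p > 0] cancels. *)
Lemma cauchy_schwarz_Re x y : complex.Re (ip x y) ^+ 2 <= nsq ip x * nsq ip y.
Proof.
have [->|x0] := eqVneq x 0; first by rewrite /nsq !ip0l /= expr0n mul0r.
have p0 : 0 < nsq ip x by exact: (ip_pos hH).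
have := nsq_ge0 (((nsq ip x)%:C)%C *: y - ((complex.Re (ip x y))%:C)%C *: x).
rewrite nsqD nsqN !nsqZ !cabs2_real ipNr ipZl ipZr conjc_real.
rewrite -!mulrN !Re_realM (ip_conj hH x y).
have -> : complex.Re (- conjc (ip x y)) = - complex.Re (ip x y).
  by case: (ip x y).
move: p0; set p := nsq ip x; set q := nsq ip y; set b := complex.Re _.
by move=> p0 h; rewrite -(ler_pM2l p0); move: h; lra.
Qed.

(** Replacing [y] by [ip x y *: y] makes the inner product real, equal to [s = cabs2 (ip x y)]. The
    real version then bounds [s^2] by [s] times the claimed right-hand side, and one factor [s]
    cancels. *)
Lemma cauchy_schwarz x y : cabs2 (ip x y) <= nsq ip x * nsq ip y.
Proof.
have := cauchy_schwarz_Re x (ip x y *: y).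
rewrite nsqZ ipZr.
have -> : complex.Re (conjc (ip x y) * ip x y) = cabs2 (ip x y).
  by rewrite /cabs2; case: (ip x y) => a b /=; ring.
have [->|s0] := eqVneq (cabs2 (ip x y)) 0; first by rewrite mulr_ge0 ?nsq_ge0.
have sp : 0 < cabs2 (ip x y) by rewrite lt_def s0 cabs2_ge0.
by move=> h; rewrite -(ler_pM2l sp); lra.
Qed.

Definition hilnorm x := Num.sqrt (nsq ip x).

Lemma hilnorm_ge0 x : 0 <= hilnorm x. Proof. exact: sqrtr_ge0. Qed.

Lemma sqr_hilnorm x : hilnorm x ^+ 2 = nsq ip x.
Proof. by rewrite sqr_sqrtr ?nsq_ge0. Qed.

Lemma ler_hilnormD x y : hilnorm (x + y) <= hilnorm x + hilnorm y.
Proof.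
rewrite -(@ler_pXn2r _ 2) ?nnegrE ?addr_ge0 ?hilnorm_ge0//.
rewrite sqrrD !sqr_hilnorm nsqD.
suff : complex.Re (ip x y) <= hilnorm x * hilnorm y by lra.
rewrite (le_trans (ler_norm _))//.
rewrite -(@ler_pXn2r _ 2) ?nnegrE ?mulr_ge0 ?hilnorm_ge0//.
by rewrite real_normK ?num_real// exprMn !sqr_hilnorm cauchy_schwarz_Re.
Qed.

Lemma hilnormN x : hilnorm (- x) = hilnorm x.
Proof. by rewrite /hilnorm nsqN. Qed.

Lemma hilnormZ a x : hilnorm (a *: x) = Num.sqrt (cabs2 a) * hilnorm x.
Proof. by rewrite /hilnorm nsqZ sqrtrM ?cabs2_ge0. Qed.

Lemma hilnormZr (a : R) x : hilnorm ((a%:C)%C *: x) = `|a| * hilnorm x.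
Proof. by rewrite hilnormZ cabs2_real sqrtr_sqr. Qed.

Lemma hilnorm0 : hilnorm 0 = 0.
Proof. by rewrite /hilnorm /nsq ip0l sqrtr0. Qed.

Lemma ler_hilnorm_sum (I : Type) (s : seq I) (F : I -> V) :
  hilnorm (\sum_(i <- s) F i) <= \sum_(i <- s) hilnorm (F i).
Proof.
elim/big_ind2 : _ => [|x a y b xa yb|//]; first by rewrite hilnorm0.
by rewrite (le_trans (ler_hilnormD _ _))// lerD.
Qed.

Lemma hilnorm_eq0 x : hilnorm x = 0 -> x = 0.
Proof.
move=> h; apply/eqP/negPn/negP => /(ip_pos hH).
by rewrite -/(nsq ip x) -sqr_hilnorm h expr0n ltxx.
Qed.

Lemma hilnorm_lt x (e : R) : 0 < e -> nsq ip x < e ^+ 2 -> hilnorm x < e.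
Proof.
by move=> e0; rewrite -sqr_hilnorm ltr_pXn2r// nnegrE ?hilnorm_ge0// ltW.
Qed.

(* Duality with [h = \sum_g <f, B g> g] replaces the adjoint of [B]. *)
Lemma bessel_comp (B : V -> V) (M Cb : R) (s : seq V) (f : V) :
  (forall (c : V -> R[i]) , B (\sum_(g <- s) c g *: g) = \sum_(g <- s) c g *: B g) ->
  (forall x, nsq ip (B x) <= M * nsq ip x) -> 0 < M -> 0 < Cb ->
  (forall x, \sum_(g <- s) cabs2 (ip x g) <= Cb * nsq ip x) ->
  \sum_(g <- s) cabs2 (ip f (B g)) <= Cb * M * nsq ip f.
Proof.
move=> Blin BM M0 C0 bs; pose c g := ip f (B g).
pose h := \sum_(g <- s) c g *: g; set S := \sum_(g <- s) _.
have hS : nsq ip h <= Cb * S.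
  (* Here [nsq ip h] is the sum of [Re (conjc (c g) * ip h g)]. Young's inequality with weight [Cb]
     is applied termwise; the Bessel bound at [h] turns the remainder into [nsq ip h], which is
     absorbed. *)
  have : 2 * nsq ip h <= Cb * S + nsq ip h.
    rewrite {1}/nsq {2}/h ip_sumr raddf_sum/= mulr_sumr.
    have le1 : forall (z w : R[i]), 2 * complex.Re (conjc z * w) <=
        Cb * cabs2 z + Cb^-1 * cabs2 w.
      move=> [z1 z2] [w1 w2]; rewrite /cabs2 /=.
      have := sqr_ge0 (Cb * z1 - w1); have := sqr_ge0 (Cb * z2 - w2) => h1 h2.
      rewrite -(ler_pM2l C0) [leRHS]mulrDr mulVKf ?gt_eqF//; lra.
    apply: (@le_trans _ _ (\sum_(g <- s) (Cb * cabs2 (c g) + Cb^-1 * cabs2 (ip h g)))).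
      by apply: ler_sum => g _; rewrite ipZr le1.
    rewrite big_split/= -!mulr_sumr lerD2l -(ler_pM2l C0) mulVKf ?gt_eqF//.
  by lra.
(* Since [S = Re (ip f (B h))], Young's inequality with weight [Cb * M] leaves the remainder [nsq ip
   (B h) / (Cb * M) <= nsq ip h / Cb <= S], absorbed on the left. *)
have : 2 * S <= Cb * M * nsq ip f + S.
  have CM0 : 0 < Cb * M by rewrite mulr_gt0.
  have SE : complex.Re (ip f (B h)) = S.
    rewrite Blin ip_sumr raddf_sum/=; apply: eq_bigr => g _.
    by rewrite ipZr -/(c g) /cabs2; case: (c g) => a b /=; ring.
  rewrite -{1}SE (le_trans (young_ip f (B h) CM0))//.
  rewrite lerD2l -(ler_pM2l CM0) mulVKf ?gt_eqF//.
  by rewrite (le_trans (BM _))// mulrAC [_ * M]mulrC ler_pM2l.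
by lra.
Qed.

End InnerProduct.

(** * Real estimates for the exponential series *)

Section RealExponential.
Set Implicit Arguments. Unset Strict Implicit.
Variable R : realType.
Implicit Types (r s t x : R) (n k : nat).

Lemma sum_exp_coeff_le n x : 0 <= x -> \sum_(k < n) x ^+ k / k`!%:R <= expR x.
Proof.
move=> x0.
have -> : \sum_(k < n) x ^+ k / k`!%:R = series (exp_coeff x) n.
  by rewrite /series/= big_mkord.
apply: nondecreasing_cvgn_le; last exact: is_cvg_series_exp_coeff.
apply/nondecreasing_seqP => i; rewrite /series/= big_nat_recr//= lerDl.
exact: exp_coeff_ge0.
Qed.

(** The difference factors as [t - s] times a sum of [k+1] monomials of degree [k], each at most
    [r^k] in absolute value. *)
Lemma ler_normXB r s t k : `|s| <= r -> `|t| <= r ->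
  `|t ^+ k.+1 - s ^+ k.+1| <= `|t - s| * (k.+1%:R * r ^+ k).
Proof.
move=> sr tr; have r0 : 0 <= r by rewrite (le_trans _ sr).
rewrite subrXX normrM ler_wpM2l//.
rewrite (le_trans (ler_norm_sum _ _ _))//.
rewrite -[k.+1 in leRHS]card_ord mulr_natl -sumr_const ler_sum// => i _ /=.
have ik : (i <= k)%N by rewrite -ltnS.
rewrite -[in leRHS](subnK ik) exprD normrM !normrX.
by rewrite ler_pM ?exprn_ge0// lerXn2r// nnegrE.
Qed.

End RealExponential.

(** * The operator exponential: linearity and Lipschitz dependence on time *)

Section OperatorExponential.
Set Implicit Arguments. Unset Strict Implicit.
Variables (R : realType) (V : lmodType R[i]) (ip : V -> V -> R[i]).
Hypothesis hH : is_sep_Hilbert ip.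
Variable A : {linear V -> V}.
Hypothesis hA : bounded_op ip A.
Variable E : R -> V -> V.
Hypothesis hE : is_exp_op ip A E.
Let N := hilnorm ip.

Lemma bounded_op_hilnorm : exists2 a : R, 0 < a & forall x, N (A x) <= a * N x.
Proof.
case: hA => M AM; have a1 : 1 <= `|M| + 1 by rewrite lerDr.
have a0 : 0 < `|M| + 1 by rewrite (lt_le_trans _ a1).
(* For [a = 1 + abs M] one has [M <= a <= a^2], so [a] bounds norms where [M] bounds squared
   norms. *)
exists (`|M| + 1) => // x.
rewrite -(@ler_pXn2r _ 2) ?nnegrE ?mulr_ge0 ?hilnorm_ge0 ?(ltW a0)//.
rewrite exprMn !(sqr_hilnorm hH) (le_trans (AM x))//.
rewrite ler_wpM2r ?nsq_ge0// (@le_trans _ _ (`|M| + 1))//.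
  by rewrite (le_trans (ler_norm _))// lerDl.
by rewrite -[leLHS]expr1 ler_weXn2l.
Qed.

Lemma hilnorm_iter (a : R) k x : 0 <= a -> (forall x, N (A x) <= a * N x) ->
  N (iter k A x) <= a ^+ k * N x.
Proof.
move=> a0 Aa; elim: k => [|k IH] /=; first by rewrite mul1r.
by rewrite (le_trans (Aa _))// exprS -mulrA ler_wpM2l.
Qed.

Definition exp_psum (t : R) n x :=
  \sum_(k < n) ((t ^+ k / (k`!)%:R)%:C)%C *: iter k A x.

Lemma exp_psum_cvg t x e : 0 < e ->
  exists n0, forall n, (n0 <= n)%N -> N (exp_psum t n x - E t x) < e.
Proof.
move=> e0; have [n0 h] := hE t x (exprn_gt0 2 e0).
by exists n0 => n /h; exact: hilnorm_lt.
Qed.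

Lemma iter_linear k (c : R[i]) x y :
  iter k A (c *: x + y) = c *: iter k A x + iter k A y.
Proof. by elim: k => //= k ->; rewrite linearP. Qed.

Lemma exp_psum_linear t n (c : R[i]) x y :
  exp_psum t n (c *: x + y) = c *: exp_psum t n x + exp_psum t n y.
Proof.
rewrite /exp_psum scaler_sumr -big_split/=; apply: eq_bigr => k _.
by rewrite iter_linear scalerDr !scalerA [c * _]mulrC.
Qed.

Lemma hilnorm_small x : (forall e, 0 < e -> N x <= e) -> x = 0.
Proof.
move=> h; apply: (hilnorm_eq0 hH); apply/eqP; rewrite eq_le hilnorm_ge0 andbT.
by apply/ler_addgt0Pl => e /h; rewrite addr0.
Qed.

(** [E t] is given only as a pointwise limit; linearity is inherited from the partial sums. *)
Lemma exp_op_linear t (c : R[i]) x y : E t (c *: x + y) = c *: E t x + E t y.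
Proof.
apply/eqP; rewrite -subr_eq0; apply/eqP/hilnorm_small => e e0.
pose al := Num.sqrt (cabs2 c); have al0 : 0 <= al by exact: sqrtr_ge0.
(* Three approximation errors of this size, entering with weights 1, [al] and 1, add up to [e]. *)
have d0 : 0 < e / (al + 2) by rewrite divr_gt0// ltr_wpDl.
have [n1 h1] := exp_psum_cvg t (c *: x + y) d0.
have [n2 h2] := exp_psum_cvg t x d0.
have [n3 h3] := exp_psum_cvg t y d0.
pose n := maxn n1 (maxn n2 n3).
have {}h1 := ltW (h1 n (leq_maxl _ _)).
have {}h2 := ltW (h2 n (leq_trans (leq_maxl _ _) (leq_maxr _ _))).
have {}h3 := ltW (h3 n (leq_trans (leq_maxr _ _) (leq_maxr _ _))).
have -> : E t (c *: x + y) - (c *: E t x + E t y) =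
    - (exp_psum t n (c *: x + y) - E t (c *: x + y)) +
    (c *: (exp_psum t n x - E t x) + (exp_psum t n y - E t y)).
  rewrite exp_psum_linear scalerBr opprB [(c *: _ - _) + _]addrACA.
  by rewrite [RHS]addrA subrK opprD.
rewrite (le_trans (ler_hilnormD hH _ _))// (hilnormN hH).
apply: (@le_trans _ _ (e / (al + 2) + (al * (e / (al + 2)) + e / (al + 2)))).
  rewrite lerD// (le_trans (ler_hilnormD hH _ _))// lerD// (hilnormZ hH).
  by rewrite ler_wpM2l.
have -> : e / (al + 2) + (al * (e / (al + 2)) + e / (al + 2)) =
  (al + 2) * (e / (al + 2)) by ring.
by rewrite mulrC divfK// gt_eqF// ltr_wpDl.
Qed.

Lemma exp_op0 x : E 0 x = x.
Proof.
apply/eqP; rewrite -subr_eq0 -oppr_eq0 opprB; apply/eqP/hilnorm_small => e e0.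
have [n h] := exp_psum_cvg 0 x e0; move/(_ n.+1 (leqnSn _)): h.
rewrite /exp_psum big_ord_recl/= expr0 divr1 scale1r big1 ?addr0; first exact: ltW.
by move=> i _; rewrite expr0n/= mul0r scale0r.
Qed.

Lemma exp_op_sum t (s : seq V) (c : V -> R[i]) :
  E t (\sum_(g <- s) c g *: g) = \sum_(g <- s) c g *: E t g.
Proof.
have Et0 : E t 0 = 0.
  by have := exp_op_linear t (-1) 0 0; rewrite addr0 scaler0 scaleN1r addNr.
elim: s => [|g s IH]; first by rewrite !big_nil.
by rewrite !big_cons exp_op_linear IH.
Qed.

(** The partial sums are compared term by term. The factor [k+1] from [ler_normXB] cancels against
    the factorial of [k+1], leaving [a |t - s| (r a)^k / k!] times [N x], which sums to the constant
    [a * expR (r * a)]. *)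
Lemma exp_op_lipschitz (r : R) : 0 <= r -> exists2 K : R, 0 < K &
  forall s t x, `|s| <= r -> `|t| <= r -> N (E t x - E s x) <= K * `|t - s| * N x.
Proof.
move=> r0; have [a a0 Aa] := bounded_op_hilnorm.
exists (a * expR (r * a)); first by rewrite mulr_gt0 ?expR_gt0.
move=> s t x sr tr.
have psB n : N (exp_psum t n x - exp_psum s n x) <= a * expR (r * a) * `|t - s| * N x.
  rewrite /exp_psum -sumrB (le_trans (ler_hilnorm_sum hH _ _))//.
  have -> : a * expR (r * a) * `|t - s| * N x =
      expR (r * a) * (`|t - s| * a * N x) by ring.
  (* The constant terms of the two partial sums cancel, so the index shifts by one and [n.-1] terms
     remain. *)
  apply: (@le_trans _ _ (\sum_(k < n.-1) ((r * a) ^+ k / k`!%:R) * (`|t - s| * a * N x))).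
    case: n => [|n]; first by rewrite big_ord0 big_ord0.
    rewrite big_ord_recl/= subrr (hilnorm0 hH) add0r; apply: ler_sum => k _.
    rewrite /bump leq0n add1n -scalerBl -rmorphB/= (hilnormZr hH) -mulrBl normrM -iterS.
    rewrite (le_trans (ler_wpM2l _ (hilnorm_iter _ _ (ltW a0) Aa)))//.
    rewrite -/N !mulrA ler_wpM2r ?hilnorm_ge0//.
    rewrite normfV normr_nat factS natrM invfM.
    have k1 : 0 < (k.+1%:R : R) by rewrite ltr0n.
    apply: (@le_trans _ _ (`|t - s| * (k.+1%:R * r ^+ k) *
       (k.+1%:R^-1 * k`!%:R^-1) * a ^+ k.+1)).
      by rewrite add0n !ler_wpM2r ?(exprn_ge0 _ (ltW a0))//
        ?mulr_ge0 ?invr_ge0 ?ler0n// ler_normXB.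
    rewrite exprMn exprS.
    suff -> : `|t - s| * (k.+1%:R * r ^+ k) * (k.+1%:R^-1 * k`!%:R^-1) * (a * a ^+ k) =
      (k.+1%:R / k.+1%:R) * (r ^+ k * a ^+ k / k`!%:R * `|t - s| * a).
      by rewrite mulfV ?gt_eqF// mul1r.
    by ring.
  rewrite -mulr_suml ler_wpM2r ?mulr_ge0 ?hilnorm_ge0 ?(ltW a0)//.
  by rewrite sum_exp_coeff_le// mulr_ge0// ltW.
(* Passage to the limit: at a common index both partial sums are within [e / 2] of their limits. *)
apply/ler_addgt0Pr => e e0.
have e2 : 0 < e / 2 by rewrite divr_gt0.
have [n1 h1] := exp_psum_cvg t x e2; have [n2 h2] := exp_psum_cvg s x e2.
have {}h1 := ltW (h1 _ (leq_maxl n1 n2)); have {}h2 := ltW (h2 _ (leq_maxr n1 n2)).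
move: (maxn n1 n2) h1 h2 (psB (maxn n1 n2)) => n h1 h2 h3.
have -> : E t x - E s x = - (exp_psum t n x - E t x) +
    ((exp_psum t n x - exp_psum s n x) + (exp_psum s n x - E s x)).
  by rewrite opprB !addrA !subrK.
rewrite (le_trans (ler_hilnormD hH _ _))// (hilnormN hH).
have -> : forall b, b + e = e / 2 + (b + e / 2) by move=> b; lra.
by rewrite lerD// (le_trans (ler_hilnormD hH _ _))// lerD.
Qed.

End OperatorExponential.

(** * Sums over sets and finite sums *)

Section EsumFiniteSums.
Set Implicit Arguments. Unset Strict Implicit.
Variables (R : realType) (T : choiceType).
Implicit Types (I : set T) (a : T -> \bar R).

Lemma esum_le I a (B : \bar R) :
  (forall s : seq T, uniq s -> (forall x, x \in s -> I x) ->
     (\sum_(i <- s) a i <= B)%E) -> (\esum_(i in I) a i <= B)%E.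
Proof.
move=> h; apply: ge_ereal_sup => _ [X [finX XI] <-].
rewrite fsbig_finite//=; apply: h; first exact: finmap.fset_uniq.
by move=> x; rewrite in_fset_set// inE => /XI.
Qed.

Lemma sum_le_esum I a (s : seq T) : uniq s -> (forall x, x \in s -> I x) ->
  (\sum_(i <- s) a i <= \esum_(i in I) a i)%E.
Proof.
move=> us sI; apply: esum_ge; exists [set` s]; first by split.
by rewrite fsbig_seq.
Qed.

Lemma sum_le_size (s : seq T) a (B : R) :
  (forall x, x \in s -> (a x <= B%:E)%E) ->
  (\sum_(i <- s) a i <= ((size s)%:R * B)%:E)%E.
Proof.
elim: s => [|x s IH] h; first by rewrite big_nil mul0r.
rewrite big_cons -natr1 addrC mulrDl mul1r EFinD leeD ?h ?mem_head// IH//.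
by move=> y ys; rewrite h// in_cons ys orbT.
Qed.

End EsumFiniteSums.

(** Tonelli for nonnegative families, after swapping coordinates: the frame sum splits into one sum
    over [G] per sampling time. *)
Lemma esum_setX_seq (R : realType) (T U : choiceType) (G : set T) (r : seq U)
    (a : T * U -> \bar R) : uniq r -> (forall p, 0 <= a p)%E ->
  (\esum_(p in G `*` [set` r]) a p =
   \sum_(s <- r) \esum_(g in G) a (g, s))%E.
Proof.
move=> ur a0; rewrite fsbig_seq// -esum_fset//; last first.
  by move=> s _; apply: esum_ge0.
rewrite (@esum_esum _ _ _ [set` r] (fun=> G) (fun s g => a (g, s)))//.
rewrite (@reindex_esum _ _ _ ([set` r] `*`` (fun=> G)) (G `*` [set` r])
  (fun p => (p.2, p.1)))//.
split.
- by move=> [s g] [].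
- by move=> [s g] [s' g'] _ _ [-> ->].
- by move=> [g s] [Gg Ss]; exists (s, g).
Qed.

Lemma locally_lipschitz_continuous (R : realType) (h : R -> R) :
  (forall r, 0 <= r -> exists K : R, forall s t, `|s| <= r -> `|t| <= r ->
     `|h t - h s| <= K * `|t - s|) -> continuous h.
Proof.
(* The ball of radius [|s| + 1] contains the unit neighbourhood of [s], so one Lipschitz constant
   serves near [s]. *)
move=> hl s; have r0 : 0 <= `|s| + 1 by rewrite addr_ge0.
have [K hK] := hl _ r0; have K1 : 0 < `|K| + 1 by rewrite ltr_wpDl.
apply/cvgrPdist_le => e e0; near=> t.
have ts1 : `|s - t| <= 1 by near: t; exact: cvgr_dist_le.
have tse : `|s - t| <= e / (`|K| + 1).
  by near: t; apply: cvgr_dist_le => //; rewrite divr_gt0.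
have tr : `|t| <= `|s| + 1.
  have := ler_normB s (s - t); rewrite opprB addrC subrK => h1.
  by rewrite (le_trans h1)// lerD2l.
rewrite (le_trans (hK _ _ tr _))// ?lerDl//.
rewrite (@le_trans _ _ ((`|K| + 1) * `|s - t|))//.
  by rewrite ler_wpM2r// (le_trans (ler_norm _))// lerDl.
by rewrite mulrC -ler_pdivlMr.
Unshelve. all: by end_near. Qed.

(** * Time slices of the orbit, their integrals, and the two frame transfers *)

Section ExponentialOrbit.
Set Implicit Arguments. Unset Strict Implicit.
Variables (R : realType) (V : lmodType R[i]) (ip : V -> V -> R[i]).
Hypothesis hH : is_sep_Hilbert ip.
Variable A : {linear V -> V}.
Hypothesis hA : bounded_op ip A.
Variable E : R -> V -> V.
Hypothesis hE : is_exp_op ip A E.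
Notation mu := (@lebesgue_measure R).

Let ipB f x y : ip f (x - y) = ip f x - ip f y.
Proof. by rewrite (ipDr hH) (ipNr hH). Qed.

(** Cauchy-Schwarz against [f] transfers the Lipschitz bound of the orbit to its coefficients.
    Bounding the modulus covers real and imaginary parts at once, whence continuity and
    measurability of the integrands. *)
Lemma sqrt_cabs2_orbit_lipschitz f g r : 0 <= r -> exists K : R, forall s t,
  `|s| <= r -> `|t| <= r ->
  Num.sqrt (cabs2 (ip f (E t g) - ip f (E s g))) <= K * `|t - s|.
Proof.
move=> r0; have [K K0 hK] := exp_op_lipschitz hH hA hE r0.
exists (hilnorm ip f * (K * hilnorm ip g)) => s t sr tr.
rewrite -ipB (@le_trans _ _ (hilnorm ip f * hilnorm ip (E t g - E s g)))//.
  by rewrite /hilnorm -sqrtrM ?(nsq_ge0 hH)// ler_wsqrtr// cauchy_schwarz.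
rewrite -mulrA ler_wpM2l ?hilnorm_ge0// (le_trans (hK _ _ _ sr tr))//.
by rewrite mulrAC.
Qed.

Lemma continuous_cabs2_orbit f g : continuous (fun t => cabs2 (ip f (E t g))).
Proof.
have sq (x y : R) : x ^+ 2 <= y -> `|x| <= Num.sqrt y.
  by move=> xy; rewrite -sqrtr_sqr ler_wsqrtr.
have cRe : continuous (fun t => complex.Re (ip f (E t g))).
  apply: locally_lipschitz_continuous => r /(sqrt_cabs2_orbit_lipschitz f g)[K hK].
  exists K => s t sr tr; apply: le_trans (hK _ _ sr tr).
  by rewrite -raddfB; apply: sq; rewrite lerDl sqr_ge0.
have cIm : continuous (fun t => complex.Im (ip f (E t g))).
  apply: locally_lipschitz_continuous => r /(sqrt_cabs2_orbit_lipschitz f g)[K hK].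
  exists K => s t sr tr; apply: le_trans (hK _ _ sr tr).
  by rewrite -raddfB; apply: sq; rewrite lerDr sqr_ge0.
move=> t; apply: (@cvgD _ _ _ _ _ (fun t => complex.Re (ip f (E t g)) ^+ 2)
   (fun t => complex.Im (ip f (E t g)) ^+ 2)).
- by rewrite expr2; apply: cvgM; exact: cRe.
- by rewrite expr2; apply: cvgM; exact: cIm.
Qed.

Lemma measurable_cabs2_orbit f g (D : set R) :
  measurable_fun D (EFin \o (fun t : R => cabs2 (ip f (E t g)))).
Proof.
apply/measurable_EFinP; apply: measurable_funTS.
by apply: continuous_measurable_fun; exact: continuous_cabs2_orbit.
Qed.

Section IntegralBounds.
Variables (f : V) (s : seq V) (a b : R).
Hypothesis ab : a <= b.

Let intE : (\sum_(g <- s) \int[mu]_(t in `[a, b]) (cabs2 (ip f (E t g)))%:E =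
  \int[mu]_(t in `[a, b]) (\sum_(g <- s) cabs2 (ip f (E t g)))%:E)%E.
Proof.
rewrite -ge0_integral_sum//.
- by apply: eq_integral => t _; rewrite sumEFin.
- by move=> g; exact: measurable_cabs2_orbit.
- by move=> g t _; rewrite lee_fin cabs2_ge0.
Qed.

Let mS : measurable_fun `[a, b]
  (EFin \o (fun t : R => \sum_(g <- s) cabs2 (ip f (E t g)))).
Proof.
rewrite [X in measurable_fun _ X](_ : _ =
  fun t => (\sum_(g <- s) (cabs2 (ip f (E t g)))%:E)%E); last first.
  by apply/funext => t; rewrite /= sumEFin.
by apply: emeasurable_sum => g _; exact: measurable_cabs2_orbit.
Qed.

Let int_cst (B : R) : (\int[mu]_(t in `[a, b]) B%:E = ((b - a) * B)%:E)%E.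
Proof.
rewrite integral_cst//= lebesgue_measure_itv/= lte_fin.
case: ltP => [_|ba]; first by rewrite -EFinB -EFinM mulrC.
have -> : a = b by apply/le_anti; rewrite ab ba.
by rewrite mule0 subrr mul0r.
Qed.

Lemma sum_integral_le (B : R) :
  (forall t, a <= t <= b -> \sum_(g <- s) cabs2 (ip f (E t g)) <= B) ->
  (\sum_(g <- s) \int[mu]_(t in `[a, b]) (cabs2 (ip f (E t g)))%:E
   <= ((b - a) * B)%:E)%E.
Proof.
move=> hB; rewrite intE -int_cst; apply: ge0_le_integral => //.
- by move=> t _; rewrite lee_fin sumr_ge0// => g _; exact: cabs2_ge0.
Qed.

Lemma sum_integral_ge (B : R) :
  (forall t, a <= t <= b -> B <= \sum_(g <- s) cabs2 (ip f (E t g))) ->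
  (((b - a) * B)%:E <=
   \sum_(g <- s) \int[mu]_(t in `[a, b]) (cabs2 (ip f (E t g)))%:E)%E.
Proof.
have pos t : 0 <= \sum_(g <- s) cabs2 (ip f (E t g)).
  by rewrite sumr_ge0// => g _; exact: cabs2_ge0.
(* The level [B] may be negative, namely when an error term exceeds the slice it is subtracted from;
   nonnegativity of the integral then suffices. *)
move=> hB; rewrite intE; have [B0|B0] := leP 0 B.
  by rewrite -int_cst; apply: ge0_le_integral => //.
apply: (@le_trans _ _ 0%E); first by rewrite lee_fin mulr_ge0_le0 ?subr_ge0// ltW.
by apply: integral_ge0 => t _; rewrite lee_fin.
Qed.

End IntegralBounds.

Variables (G : set V) (Cb L : R).
Hypotheses (Cb0 : 0 < Cb) (L0 : 0 < L).
Hypothesis hGb : forall f,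
  (\esum_(g in G) (cabs2 (ip f g))%:E <= (Cb * nsq ip f)%:E)%E.

(** This is [bessel_comp] for the difference [E t - E s], whose norm is at most [K |t - s|]. *)
Lemma bessel_exp_opB : exists2 K : R, 0 < K &
  forall f s t (X : seq V), uniq X -> (forall x, x \in X -> G x) ->
    0 <= s <= L -> 0 <= t <= L ->
    \sum_(g <- X) cabs2 (ip f (E t g - E s g)) <= K * (t - s) ^+ 2 * nsq ip f.
Proof.
have [K K0 hK] := exp_op_lipschitz hH hA hE (ltW L0).
exists (Cb * K ^+ 2); first by rewrite mulr_gt0 ?exprn_gt0.
move=> f s t X uX XG /andP[s0 sL] /andP[t0 tL].
(* [bessel_comp] asks for a positive operator bound, so equal times are treated apart. *)
have [->|ts] := eqVneq t s.
  rewrite subrr expr0n mulr0 mul0r big1// => g _.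
  by rewrite subrr (ip0r hH) /cabs2 /= expr0n addr0.
rewrite -[Cb * _ * _]mulrA -exprMn.
apply: (bessel_comp hH (B := fun x => E t x - E s x)) => //.
- move=> c; rewrite !(exp_op_sum hH hE) -sumrB; apply: eq_bigr => g _.
  by rewrite scalerBr.
- move=> x; rewrite -!(sqr_hilnorm hH) exprMn -(real_normK (num_real (t - s))).
  rewrite -exprMn -exprMn ler_pXn2r ?nnegrE ?mulr_ge0 ?hilnorm_ge0 ?(ltW K0)//.
  by rewrite hK// ger0_norm.
- by rewrite exprn_even_gt0//= mulf_neq0 ?subr_eq0// gt_eqF.
- by move=> x; rewrite -lee_fin -sumEFin (le_trans _ (hGb x))// sum_le_esum.
Qed.

Lemma slice_bound : exists2 K : R, 0 < K &
  forall f s t (X : seq V), uniq X -> (forall x, x \in X -> G x) ->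
    0 <= s <= L -> 0 <= t <= L ->
    \sum_(g <- X) cabs2 (ip f (E t g)) <=
      2 * \sum_(g <- X) cabs2 (ip f (E s g)) + K * (t - s) ^+ 2 * nsq ip f.
Proof.
have [K K0 hK] := bessel_exp_opB; exists (2 * K); first by rewrite mulr_gt0.
move=> f s t X uX XG sL tL; have {hK} := hK f s t X uX XG sL tL.
rewrite -(ler_pM2l (x := 2))// -!mulrA !mulrA => h.
apply: le_trans (lerD (lexx _) h); rewrite !mulr_sumr -big_split/=.
apply: ler_sum => g _; rewrite ipB.
case: (ip f (E t g)) (ip f (E s g)) => [z1 z2] [w1 w2]; rewrite /cabs2 /=.
(* These squares are exactly the gap in [|z|^2 <= 2 |w|^2 + 2 |z - w|^2], one per coordinate. *)
have := sqr_ge0 (z1 - 2 * w1); have := sqr_ge0 (z2 - 2 * w2); lra.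
Qed.

(** Compare with time 0, where the slice is the Bessel sum of [G] itself. *)
Lemma slice_upper : exists2 B : R, 0 < B &
  forall f t (X : seq V), uniq X -> (forall x, x \in X -> G x) -> 0 <= t <= L ->
    \sum_(g <- X) cabs2 (ip f (E t g)) <= B * nsq ip f.
Proof.
have [K K0 hK] := slice_bound.
exists (2 * Cb + K * L ^+ 2).
  by rewrite ltr_wpDr ?mulr_gt0// mulr_ge0 ?sqr_ge0 ?ltW.
move=> f t X uX XG tL; have z : 0 <= (0 : R) <= L by rewrite lexx ltW.
apply: (le_trans (hK f 0 t X uX XG z tL)); rewrite [leRHS]mulrDl lerD//.
  rewrite -mulrA ler_pM2l//; under eq_bigr do rewrite (exp_op0 hH hE).
  by rewrite -lee_fin -sumEFin (le_trans _ (hGb f))// sum_le_esum.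
case/andP: tL => t0 tL; rewrite ler_wpM2r ?(nsq_ge0 hH)// ler_pM2l// subr0.
by rewrite ler_pXn2r// nnegrE// ltW.
Qed.

Lemma frame_fam_upper (r : seq R) : uniq r -> (forall t, t \in r -> 0 <= t <= L) ->
  exists2 B : R, 0 < B & forall f,
  (\esum_(p in G `*` [set` r]) (cabs2 (ip f (E p.2 p.1)))%:E <= (B * nsq ip f)%:E)%E.
Proof.
move=> ur rL; have [B B0 hB] := slice_upper.
(* The successor keeps the constant positive when [r] is empty. *)
exists ((size r).+1%:R * B) => [|f]; first by rewrite mulr_gt0.
rewrite esum_setX_seq//; last by move=> p; rewrite lee_fin cabs2_ge0.
apply: (@le_trans _ _ ((size r)%:R * (B * nsq ip f))%:E).
  apply: sum_le_size => t /rL tL /=.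
  by apply: esum_le => X uX XG; rewrite sumEFin lee_fin hB.
by rewrite lee_fin -mulrA ler_wpM2r ?ler_nat// mulr_ge0 ?(nsq_ge0 hH)// ltW.
Qed.

Lemma semicont_frame_upper : exists2 B : R, 0 < B & forall f,
  (\esum_(g in G) \int[mu]_(t in `[0%R, L]%classic) (cabs2 (ip f (E t g)))%:E
   <= (B * nsq ip f)%:E)%E.
Proof.
have [B B0 hB] := slice_upper; exists (L * B) => [|f]; first by rewrite mulr_gt0.
apply: esum_le => X uX XG; rewrite -mulrA -[X in (X * _)%:E]subr0.
by apply: sum_integral_le => [|t tL]; [rewrite ltW|exact: hB].
Qed.

Lemma frame_fam_of_semicont (c : R) : 0 < c ->
  (forall f, ((c * nsq ip f)%:E <= \esum_(g in G)
     \int[mu]_(t in `[0%R, L]%classic) (cabs2 (ip f (E t g)))%:E)%E) ->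
  exists2 delta : R, 0 < delta & forall r : seq R, uniq r ->
    (forall t, t \in r -> 0 <= t <= L) ->
    (forall u, 0 <= u <= L -> exists2 t, t \in r & `|u - t| < delta) ->
    frame_fam ip (G `*` [set` r]) (fun p : V * R => E p.2 p.1).
Proof.
move=> c0 hc; have [K K0 hK] := slice_bound.
have LK0 : 0 < 2 * L * K by rewrite !mulr_gt0.
(* As [delta <= 1], [delta^2 <= delta <= c / (2 L K)], so the integrated error costs at most half of
   [c]. *)
pose delta := Num.min 1 (c / (2 * L * K)).
have d0 : 0 < delta by rewrite lt_min ltr01 divr_gt0.
have d2 : L * K * delta ^+ 2 <= c / 2.
  have : delta ^+ 2 <= c / (2 * L * K).
    have d1 : delta <= 1 by rewrite ge_min lexx.
    have dc : delta <= c / (2 * L * K) by rewrite ge_min lexx orbT.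
    by rewrite (le_trans _ dc)// expr2 ler_piMl// ltW.
  by rewrite ler_pdivlMr//; lra.
exists delta => // r ur rL rnear; have [B B0 hB] := frame_fam_upper ur rL.
(* After absorption [c / 2 * nsq ip f <= 2 L S], with [S] the frame sum. *)
exists (c / (4 * L)), B; split=> //; first by rewrite divr_gt0// mulr_gt0.
move=> f; split; last exact: hB.
move: (hB f); set S := esum _ _ => SB.
have S0 : (0 <= S)%E by apply: esum_ge0 => p _; rewrite lee_fin cabs2_ge0.
have Sfin : S \is a fin_num by rewrite ge0_fin_numE// (le_lt_trans SB)// ltry.
rewrite -(fineK Sfin) lee_fin.
have nsq0 := nsq_ge0 hH f.
have sliceS (X : seq V) t : uniq X -> (forall x, x \in X -> G x) -> t \in r ->
    \sum_(g <- X) cabs2 (ip f (E t g)) <= fine S.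
  move=> uX XG tr; rewrite -lee_fin fineK// -sumEFin.
  rewrite -[leLHS](big_map (fun g => (g, t)) xpredT
    (fun p : V * R => (cabs2 (ip f (E p.2 p.1)))%:E)).
  apply: sum_le_esum; first by rewrite map_inj_uniq// => x y [].
  by move=> _ /mapP[g gX ->]; split => //; exact: XG.
have key : c * nsq ip f <= L * (2 * fine S + K * delta ^+ 2 * nsq ip f).
  rewrite -lee_fin (le_trans (hc f))//; apply: esum_le => X uX XG.
  rewrite -[X in (X * _)%:E]subr0; apply: sum_integral_le => [|u uL]; first exact: ltW.
  have [t tr ut] := rnear u uL.
  rewrite (le_trans (hK f t u X uX XG (rL t tr) uL))// lerD//.
    by rewrite ler_pM2l// sliceS.
  rewrite ler_wpM2r// ler_pM2l// -(real_normK (num_real (u - t))).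
  by rewrite ler_pXn2r ?nnegrE ?(ltW d0)// ltW.
rewrite mulrAC ler_pdivrMr ?mulr_gt0//; move: key; rewrite mulrDr.
have := ler_wpM2r nsq0 d2.
lra.
Qed.

Lemma semicont_of_frame_fam (r : seq R) (c : R) : uniq r ->
  (forall t, t \in r -> 0 <= t <= L) -> 0 < c ->
  (forall f, ((c * nsq ip f)%:E <=
     \esum_(p in G `*` [set` r]) (cabs2 (ip f (E p.2 p.1)))%:E)%E) ->
  semicont_frame ip E G L.
Proof.
move=> ur rL c0 hc; have [K K0 hK] := slice_bound.
have [B B0 hB] := semicont_frame_upper.
pose m : R := (size r).+1%:R; have m0 : 0 < m by rewrite ltr0n.
have mK0 : 0 < 2 * m * K by rewrite !mulr_gt0.
(* [d] is the window length: [d <= L] lets a window fit into [[0, L]], and the other two bounds give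
   [m K d^2 <= c / 2]. *)
pose d := Num.min (Num.min 1 L) (c / (2 * m * K)).
have d0 : 0 < d by rewrite !lt_min ltr01 L0 divr_gt0.
have dL : d <= L by rewrite !ge_min lexx orbT.
have d2 : m * K * d ^+ 2 <= c / 2.
  have : d ^+ 2 <= c / (2 * m * K).
    have d1 : d <= 1 by rewrite !ge_min lexx.
    have dc : d <= c / (2 * m * K) by rewrite !ge_min lexx !orbT.
    by rewrite (le_trans _ dc)// expr2 ler_piMl// ltW.
  by rewrite ler_pdivlMr//; lra.
(* Summing [slice_le] over the sampling times and absorbing the error gives
   [c / 2 * nsq ip f <= (2 m / d) F]. *)
exists (c * d / (4 * m)), B; split=> //; first by rewrite divr_gt0// mulr_gt0.
move=> f F; split; last exact: hB.
have nsq0 := nsq_ge0 hH f.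
have F0 : (0 <= F)%E.
  by apply: esum_ge0 => g _; apply: integral_ge0 => t _; rewrite lee_fin cabs2_ge0.
have Ffin : F \is a fin_num by rewrite ge0_fin_numE// (le_lt_trans (hB f))// ltry.
have slice_le t : t \in r -> (\esum_(g in G) (cabs2 (ip f (E t g)))%:E <=
    (2 / d * fine F + K * d ^+ 2 * nsq ip f)%:E)%E.
  move=> tr; apply: esum_le => X uX XG; rewrite sumEFin lee_fin.
  have /andP[t0 tL] := rL t tr.
  (* The window [[u, u + d]] contains [t] and stays inside [[0, L]] even when [t] is close to
     [L]. *)
  pose u := Num.min t (L - d).
  have u0 : 0 <= u by rewrite le_min t0 subr_ge0.
  have udL : u + d <= L by rewrite -lerBrDr ge_min lexx orbT.
  have ut : u <= t by rewrite ge_min lexx.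
  have tud : t <= u + d.
    by rewrite -lerBlDr le_min lerBlDr lerDl (ltW d0) lerD2r.
  have uud : u <= u + d by rewrite lerDl ltW.
  (* Solving [slice_bound] for the slice at a time [v] of the window gives the lower bound [b],
     uniform in [v]. *)
  set S := \sum_(g <- X) _; pose b := (S - K * d ^+ 2 * nsq ip f) / 2.
  have key : d * b <= fine F.
    rewrite -lee_fin fineK//; apply: (@le_trans _ _ (\sum_(g <- X)
      \int[mu]_(v in `[0%R, L]%classic) (cabs2 (ip f (E v g)))%:E)%E); last first.
      exact: sum_le_esum.
    have -> : d * b = (u + d - u) * b by rewrite addrAC subrr add0r.
    apply: (@le_trans _ _ (\sum_(g <- X)
      \int[mu]_(v in `[u, (u + d)%R]%classic) (cabs2 (ip f (E v g)))%:E)%E).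
      apply: sum_integral_ge => // v /andP[uv vud].
      have vL : 0 <= v <= L by rewrite (le_trans u0 uv) (le_trans vud udL).
      have tL' : 0 <= t <= L by rewrite t0 tL.
      rewrite /b ler_pdivrMr// lerBlDr mulrC.
      rewrite (le_trans (hK f v t X uX XG vL tL'))// lerD2l ler_wpM2r// ler_pM2l//.
      rewrite -(real_normK (num_real (t - v))) ler_pXn2r ?nnegrE ?(ltW d0)//.
      by rewrite ler_distl; apply/andP; split; lra.
    apply: lee_sum => g _; apply: ge0_subset_integral => //.
    - exact: measurable_cabs2_orbit.
    - by move=> v _; rewrite lee_fin cabs2_ge0.
    - by move=> v; rewrite /= !in_itv/= => /andP[uv vud]; apply/andP; split; lra.
  rewrite -lerBlDr -(ler_pM2l d0).
  have -> : d * (2 / d * fine F) = (d / d) * (2 * fine F) by ring.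
  by rewrite mulfV ?gt_eqF// mul1r; move: key; rewrite /b; lra.
rewrite -(fineK Ffin) lee_fin.
have key : c * nsq ip f <= m * (2 / d * fine F + K * d ^+ 2 * nsq ip f).
  rewrite -lee_fin (le_trans (hc f))// esum_setX_seq//; last first.
    by move=> p; rewrite lee_fin cabs2_ge0.
  apply: le_trans (sum_le_size slice_le) _.
  rewrite lee_fin ler_wpM2r ?ler_nat// addr_ge0//.
    by rewrite mulr_ge0 ?fine_ge0// divr_ge0// ltW.
  by rewrite !mulr_ge0 ?sqr_ge0// ltW.
rewrite mulrAC ler_pdivrMr ?mulr_gt0//; move: key; rewrite -(ler_pM2l d0).
have -> : d * (m * (2 / d * fine F + K * d ^+ 2 * nsq ip f)) =
  (d / d) * (2 * m * fine F) + d * (m * K * d ^+ 2 * nsq ip f) by ring.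
rewrite mulfV ?gt_eqF// mul1r.
have := ler_wpM2l (ltW d0) (ler_wpM2r nsq0 d2).
lra.
Qed.

End ExponentialOrbit.

(** * Partitions of the time interval *)

Section Partitions.
Set Implicit Arguments. Unset Strict Implicit.
Variables (R : realType) (L : R) (n : nat) (t : nat -> R).
Hypotheses (n0 : (0 < n)%N) (t0 : t 0%N = 0) (tL : t n.-1 <= L).
Hypothesis tlt : forall j, (j.+1 < n)%N -> t j < t j.+1.

Let tle i j : (i <= j)%N -> (j < n)%N -> t i <= t j.
Proof.
elim: j => [|j IH]; first by rewrite leqn0 => /eqP->.
rewrite leq_eqVlt => /predU1P[->//|ij] jn.
by rewrite (le_trans (IH ij (ltnW jn)))// ltW// tlt.
Qed.

Lemma tset_seq : tset n t = [set` undup [seq t j | j <- iota 0 n]].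
Proof.
apply/seteqP; split => x /=; rewrite mem_undup.
- by move=> [j jn <-]; apply/mapP; exists j => //; rewrite mem_iota.
- by move=> /mapP[j]; rewrite mem_iota/= add0n => jn ->; exists j.
Qed.

Lemma partition_itv u : u \in undup [seq t j | j <- iota 0 n] -> 0 <= u <= L.
Proof.
rewrite mem_undup => /mapP[j]; rewrite mem_iota/= add0n => jn ->.
rewrite -t0 tle// (le_trans _ tL)// tle//; first by rewrite -ltnS prednK.
by rewrite prednK.
Qed.

(** The last sampling time not exceeding [u] works: [u] lies in the gap that follows it. *)
Lemma partition_near (delta u : R) :
  (forall j, (j < n)%N -> `|(if j.+1 == n then L else t j.+1) - t j| < delta) ->
  0 <= u <= L ->
  exists2 v, v \in undup [seq t j | j <- iota 0 n] & `|u - v| < delta.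
Proof.
move=> gap /andP[u0 uL].
have exP : exists j, (j < n)%N && (t j <= u) by exists 0%N; rewrite n0 t0.
have ubP j : (j < n)%N && (t j <= u) -> (j <= n)%N by case/andP => /ltnW.
case: (ex_maxnP exP ubP) => j /andP[jn tju] jmax.
exists (t j); first by rewrite mem_undup; apply/mapP; exists j => //; rewrite mem_iota.
apply: le_lt_trans (gap j jn).
(* After the last sampling time the gap is closed by [L]; otherwise maximality of [j] puts the next
   time beyond [u]. *)
have next : u <= if j.+1 == n then L else t j.+1.
  case: eqP => // /eqP jn1; rewrite leNgt; apply/negP => tu.
  have : (j.+1 <= j)%N.
    by apply: jmax; rewrite ltn_neqAle jn1 jn ltW.
  by rewrite ltnn.
rewrite ger0_norm ?subr_ge0// ger0_norm ?lerD2r//.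
by rewrite subr_ge0 (le_trans tju).
Qed.

End Partitions.

(** Take the times [j L / n] with [n > L / delta]. They stop at [(n-1) L / n], so the closing gap up
    to [L] has the same length. *)
Lemma uniform_partition (R : realType) (L delta : R) : 0 < L -> 0 < delta ->
  exists (n : nat) (t : nat -> R), [/\ (0 < n)%N, t 0%N = 0,
    (forall j, (j.+1 < n)%N -> t j < t j.+1), t n.-1 <= L &
    forall j, (j < n)%N -> `|(if j.+1 == n then L else t j.+1) - t j| < delta].
Proof.
move=> L0 d0; have := archi_boundP (ltW (divr_gt0 L0 d0)).
case: (Num.bound _) => [|k]; first by rewrite ltNge divr_ge0// ltW.
set n := k.+1 => hn; have n0 : 0 < (n%:R : R) by rewrite ltr0n.
have Ln0 : 0 < L / n%:R by rewrite divr_gt0.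
have Lnd : L / n%:R < delta by rewrite ltr_pdivrMr// mulrC -ltr_pdivrMr.
exists n, (fun j => j%:R * (L / n%:R)); split => //.
- by rewrite mul0r.
- by move=> j _; rewrite ltr_pM2r// ltr_nat.
- by rewrite mulrA ler_pdivrMr// mulrC ler_pM2l// ler_nat.
move=> j jn; set x := (if _ then _ else _).
have -> : x = j.+1%:R * (L / n%:R).
  by rewrite /x; case: eqP => // ->; rewrite mulrC divfK// gt_eqF.
by rewrite -mulrBl -natrB// subSnn mul1r ger0_norm// ltW.
Qed.

(** * The cycle of implications *)

Theorem mainTheorem1 (R : realType) (V : lmodType R[i]) (ip : V -> V -> R[i])
  (hH : is_sep_Hilbert ip)
  (A : {linear V -> V}) (hA : bounded_op ip A)
  (E : R -> V -> V) (hE : is_exp_op ip A E)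
  (L : R) (hL : 0 < L)
  (G : set V) (hGc : countable G) (hGb : bessel_fam ip G id) :
  [<->
   (* (i) *)
   semicont_frame ip E G L;
   (* (ii) *)
   exists2 delta : R, 0 < delta &
     forall (n : nat) (t : nat -> R),
       (0 < n)%N -> t 0%N = 0 ->
       (forall j, (j.+1 < n)%N -> t j < t j.+1) ->
       t n.-1 <= L ->
       (forall j, (j < n)%N -> `|(if j.+1 == n then L else t j.+1) - t j| < delta) ->
       frame_fam ip (G `*` tset n t) (fun p : V * R => E p.2 p.1);
   (* (iii) *)
   exists (n : nat) (t : nat -> R),
       [/\ (0 < n)%N, t 0%N = 0,
           (forall j, (j.+1 < n)%N -> t j < t j.+1),
           t n.-1 <= L &
           frame_fam ip (G `*` tset n t) (fun p : V * R => E p.2 p.1)]].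
Proof.
have [Cb [Cb0 hb]] := hGb.
tfae.
- move=> [c [C' [c0 _ hc]]].
  have hc' f := (hc f).1.
  have [delta d0 hd] := frame_fam_of_semicont hH hA hE Cb0 hL hb c0 hc'.
  exists delta => // n t n0 t0 tlt tL gap; rewrite tset_seq; apply: hd.
  + exact: undup_uniq.
  + exact: partition_itv.
  + by move=> u; exact: partition_near.
(* A uniform partition of mesh below [delta] is an instance of (ii). *)
- move=> [delta d0 hd].
  have [n [t [n0 t0 tlt tL gap]]] := uniform_partition hL d0.
  by exists n, t; split => //; exact: hd.
- move=> [n [t [n0 t0 tlt tL]]]; rewrite tset_seq => -[c [C' [c0 _ hc]]].
  apply: (semicont_of_frame_fam hH hA hE Cb0 hL hb
    (undup_uniq [seq t j | j <- iota 0 n]) _ c0).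
  + exact: partition_itv.
  + by move=> f; exact: (hc f).1.
Qed.
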